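(* For the Petersen graph $\mathsf P_{10}$, $rc^\ell(\mathsf P_{10})=3$ and $src^\ell(\mathsf P_{10})=4$.
   Context: An edge-coloured path is rainbow if all its edges have distinct colours; a geodesic is a shortest path between its endpoints. An (not necessarily proper) edge-colouring of a connected graph is rainbow connected (resp. strongly rainbow connected) if any two vertices are joined by a rainbow path (resp. rainbow geodesic). An $r$-edge-list assignment of $G$ assigns to each edge $e$ a set $L(e)\subset\mathbb N$ with $|L(e)|\ge r$; an $L$-edge-colouring is an edge-colouring $c$ with $c(e)\in L(e)$ for all $e$. $rc^\ell(G)$ (resp. $src^\ell(G)$) is the minimum integer $r$ such that for every $r$-edge-list assignment $L$ of $G$ there exists a rainbow connected (resp. strongly rainbow connected) $L$-edge-colouring of $G$. *)

(* Defs.v *)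
From mathcomp Require Import all_boot.
From mathcomp Require Import boolp classical_sets functions cardinality.
Set Implicit Arguments.
Unset Strict Implicit.
Unset Printing Implicit Defensive.

Record sgraph := SGraph {
  vertex :> finType;
  adj : rel vertex;
  adj_sym : symmetric adj;
  adj_irr : irreflexive adj }.

Section RainbowConnection.
Variable G : sgraph.
Implicit Types (x y : G) (p : seq G).

Definition edges : {set {set G}} :=
  [set [set u.1; u.2]%SET | u : G * G & adj u.1 u.2]%SET.

(* The path is x :: p, so its length is size p. *)
Definition is_path x y p : Prop :=
  [/\ path (@adj G) x p, uniq (x :: p) & last x p = y].

Definition is_geodesic x y p : Prop :=
  is_path x y p /\ forall q, is_path x y q -> size p <= size q.

Definition path_edges x p : seq {set G} :=
  pairmap (fun u v => [set u; v]%SET) x p.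

(* Colourings and list assignments are total on {set G}; only their values on
   edges G matter. *)
Implicit Types (c : {set G} -> nat) (L : {set G} -> set nat).

Definition rainbow c x p : bool := uniq [seq c e | e <- path_edges x p].

Definition rainbow_connected c : Prop :=
  forall x y, exists p, is_path x y p /\ rainbow c x p.

Definition strongly_rainbow_connected c : Prop :=
  forall x y, exists p, is_geodesic x y p /\ rainbow c x p.

(* Lists may be infinite: |L e| >= r says that {0, ..., r-1} injects in L e. *)
Definition edge_list_assignment (r : nat) L : Prop :=
  forall e, e \in edges -> (`I_r #<= L e)%card.

Definition list_edge_colouring L c : Prop :=
  forall e, e \in edges -> L e (c e).

Definition rc_choosable (r : nat) : Prop :=
  forall L, edge_list_assignment r L ->
  exists c, list_edge_colouring L c /\ rainbow_connected c.

Definition src_choosable (r : nat) : Prop :=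
  forall L, edge_list_assignment r L ->
  exists c, list_edge_colouring L c /\ strongly_rainbow_connected c.

End RainbowConnection.

Definition is_least (P : nat -> Prop) (r : nat) : Prop :=
  P r /\ forall s, P s -> r <= s.

(* The default 0 is reached only if no r qualifies (e.g. G disconnected) or G
   has at most one vertex, where 0 is the actual minimum. *)
Definition rcl (G : sgraph) : nat := xget 0 (is_least (@rc_choosable G)).
Definition srcl (G : sgraph) : nat := xget 0 (is_least (@src_choosable G)).

(* Outer 5-cycle (false, i), inner pentagram (true, i), spokes joining
   (false, i) to (true, i). *)
Definition petersen_adj : rel (bool * 'I_5) := fun u v =>
  if u.1 == v.1 then
    let d := if u.1 then 2 else 1 in
    (v.2 == (u.2 + d) %% 5 :> nat) || (u.2 == (v.2 + d) %% 5 :> nat)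
  else u.2 == v.2.

Lemma petersen_adj_sym : symmetric petersen_adj.
Proof.
move=> [a i] [b j]; rewrite /petersen_adj /= [b == a]eq_sym [j == i]eq_sym.
by case: eqP => [->|//]; rewrite orbC.
Qed.

Lemma petersen_adj_irr : irreflexive petersen_adj.
Proof. by case=> [[] [[|[|[|[|[|i]]]]] lti]]. Qed.

Definition petersen : sgraph := SGraph petersen_adj_sym petersen_adj_irr.

(* Main.v *)
From mathcomp Require Import all_boot all_algebra.
From mathcomp Require Import boolp classical_sets functions cardinality.
Require Import Defs.

(**
  Upper bounds: by the Alon-Tarsi method, if the coefficient of
  [\prod_i x_i ^ d_i] in [\prod_((i, j) in H) (x_i - x_j)] is nonzero and every
  list has more than [d_i] colours, the lists admit a choice of colours that
  differ along every pair of [H]. In the Petersen graph two nonadjacent vertices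
  have a unique common neighbour, so strong rainbow connection amounts to a
  proper edge colouring: [H] is the line graph and exponents at most 3 suffice.
  With lists of size 3 all 15 exponents must be 2, and the line graph (30 pairs,
  not 3-colourable) has coefficient 0; replacing three of its pairs by pairs
  that make a path of length 3 rainbow gives a nonzero coefficient.

  Lower bounds: two colours only allow rainbow paths of length at most 2, so the
  three edges at a vertex would need distinct colours; and the Petersen graph
  has no proper 3-edge-colouring.
*)

Set Implicit Arguments.
Unset Strict Implicit.
Unset Printing Implicit Defensive.
Import GRing.Theory Num.Theory.

Local Open Scope ring_scope.

(** * The Alon-Tarsi method *)

(* The coefficient of [\prod_(i <- s) x_i] in
   [\prod_(h <- H) (x_(h.1) - x_(h.2))]. *)
Fixpoint diff_coef (T : eqType) (H : seq (T * T)) (s : seq T) : int :=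
  if H is h :: H' then
    let term i := if i \in s then diff_coef H' (rem i s) else 0 in
    term h.1 - term h.2
  else (s == [::])%:Z.

Section AlonTarsi.
Variables (F : fieldType) (I : finType).

(** Distinct nodes make the Vandermonde matrix invertible; the weights are column [d] of its
    inverse. *)
Lemma dual_weights (r d : nat) (a : 'I_r -> F) : injective a -> (d < r)%N ->
  exists w : 'I_r -> F,
    forall k, (k < r)%N -> \sum_j w j * a j ^+ k = (k == d)%:R.
Proof.
move=> a_inj d_lt; pose V := Vandermonde r (\row_j a j).
have Vu : V \in unitmx.
  rewrite unitmxE det_Vandermonde unitfE; apply/prodf_neq0 => i _.
  apply/prodf_neq0 => j ij; rewrite !mxE subr_eq0.
  by apply: contraTneq ij => /a_inj ->; rewrite ltnn.
exists (fun j => invmx V j (Ordinal d_lt)) => k k_lt.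
have := mulmxV Vu => /matrixP /(_ (Ordinal k_lt) (Ordinal d_lt)).
rewrite !mxE -val_eqE /= => <-; apply: eq_bigr => j _.
by rewrite !mxE mulrC.
Qed.

Lemma prod_count_mem (x : I -> F) (m : seq I) :
  \prod_(i <- m) x i = \prod_i x i ^+ count_mem i m.
Proof.
elim: m => [|j m IH]; first by rewrite big_nil big1.
rewrite big_cons IH (bigD1 j) //= [RHS](bigD1 j) //= eqxx exprS mulrA.
by congr (_ * _); apply: eq_bigr => i /negPf ij; rewrite eq_sym ij.
Qed.

Lemma count_mem_lt (m d : seq I) : size m = size d -> ~~ perm_eq m d ->
  exists i, (count_mem i m < count_mem i d)%N.
Proof.
move=> eq_size; apply: contraNP => no_lt.
have [e sub_e perm_e] : exists2 e, subseq e m & perm_eq d e.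
  apply/count_subseqP => i; rewrite leqNgt; apply/negP => lt_i.
  by apply: no_lt; exists i.
have := size_subseq_leqif sub_e => -[_].
by rewrite -(perm_size perm_e) eq_size eqxx => /esym/eqP <-; rewrite perm_sym.
Qed.

Variables (r : nat) (a w : I -> 'I_r -> F) (d : seq I).

(* The weights [w i] integrate [x_i ^ k] to [k == count_mem i d], for [k < r];
   the functional integrates [\prod_(i <- m) x_i] times the product over [H], and
   thus reads off the coefficient of [\prod_(i <- d) x_i]. *)
Definition diff_functional (m : seq I) (H : seq (I * I)) : F :=
  \sum_(f : {ffun I -> 'I_r}) (\prod_i w i (f i)) *
    ((\prod_(i <- m) a i (f i)) * \prod_(h <- H) (a h.1 (f h.1) - a h.2 (f h.2))).

Lemma diff_functional_nil m :
  diff_functional m [::] = \prod_i \sum_j w i j * a i j ^+ count_mem i m.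
Proof.
rewrite bigA_distr_bigA; apply: eq_bigr => f _.
by rewrite big_nil mulr1 (prod_count_mem _ m) [RHS]big_split.
Qed.

Lemma diff_functional_cons m h H : diff_functional m (h :: H) =
  diff_functional (h.1 :: m) H - diff_functional (h.2 :: m) H.
Proof.
rewrite -sumrB; apply: eq_bigr => f _.
by rewrite !big_cons -mulrBr -!mulrBl; congr (_ * _); rewrite mulrCA mulrA.
Qed.

Hypothesis d_lt : forall i, (count_mem i d < r)%N.
Hypothesis w_dual : forall i k, (k < r)%N ->
  \sum_j w i j * a i j ^+ k = (k == count_mem i d)%:R.

(** The dual weights do not control powers from [r] on. This does no harm: if [m] is not a
    permutation of [d], some variable occurs less often in [m] than in [d], and its factor is 0. *)
Lemma diff_functional_nil_perm m : size m = size d ->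
  diff_functional m [::] = (perm_eq m d)%:R.
Proof.
move=> eq_size; rewrite diff_functional_nil.
have [/permP perm_md|nperm] := boolP (perm_eq m d).
  by rewrite big1 // => i _; rewrite perm_md w_dual // eqxx.
have [i lt_i] := count_mem_lt eq_size nperm.
rewrite (bigD1 i) //= w_dual ?(ltn_trans lt_i) //.
by rewrite (ltn_eqF lt_i) mul0r.
Qed.

(** Expanding the remaining factors only adds variables to [m], so the excess of [i] persists. *)
Lemma diff_functional_eq0 H m i : (size m + size H = size d)%N ->
  (count_mem i d < count_mem i m)%N -> diff_functional m H = 0.
Proof.
elim: H m => [|h H IH] m /=; last first.
  rewrite addnS -addSn => eq_size lt_i; rewrite diff_functional_cons.
  by rewrite !IH ?subr0 //= (leq_trans lt_i) ?leq_addl.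
rewrite addn0 => /diff_functional_nil_perm -> lt_i.
by case: permP => // perm_md; rewrite perm_md ltnn in lt_i.
Qed.

(** [m] collects the variables already chosen, [s] those still owed to [d]; a choice outside [s]
    creates an excess and contributes 0, as in [diff_coef]. *)
Lemma diff_functionalE H m s : perm_eq (m ++ s) d -> size s = size H ->
  diff_functional m H = (diff_coef H s)%:~R.
Proof.
elim: H m s => [|h H IH] m s perm_d eq_size.
  case: s perm_d eq_size => // perm_d _; rewrite cats0 in perm_d.
  by rewrite diff_functional_nil_perm ?perm_d // (perm_size perm_d).
have size_d : (size (h.1 :: m) + size H = size d)%N.
  by rewrite -(perm_size perm_d) size_cat eq_size addnS.
have termE i : diff_functional (i :: m) H =
    (if i \in s then diff_coef H (rem i s) else 0)%:~R.
  have [is_|is_] := ifPn; last first.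
    apply: (@diff_functional_eq0 _ _ i) => //=.
    by rewrite -(permP perm_d) count_cat (count_memPn is_) addn0 eqxx.
  apply: IH; last by rewrite size_rem // eq_size.
  apply/permP => P; rewrite -(permP perm_d) /= !count_cat.
  by rewrite (permP (perm_to_rem is_)) /= addnCA.
by rewrite diff_functional_cons !termE /= rmorphB.
Qed.

End AlonTarsi.

(** If every choice clashed along [H], all terms of the functional would vanish; yet it equals the
    coefficient, still nonzero in characteristic 0. *)
Lemma alon_tarsi (F : numFieldType) (I : finType) (r : nat) (a : I -> 'I_r -> F)
    (H : seq (I * I)) (d : seq I) :
  (forall i, injective (a i)) -> (forall i, (count_mem i d < r)%N) ->
  size d = size H -> diff_coef H d != 0 ->
  exists f : I -> 'I_r, all (fun h => a h.1 (f h.1) != a h.2 (f h.2)) H.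
Proof.
move=> a_inj d_lt size_d coef_neq0.
have [w w_dual] := choice (fun i => dual_weights (a_inj i) (d_lt i)).
have := diff_functionalE d_lt w_dual (m := [::]) (perm_refl d) size_d.
apply: contra_eqP => no_f.
rewrite eq_sym [X in _ != X]big1 ?intr_eq0 // => f _.
have /allPn[h hH /negPn/eqP eq_h] :
    ~~ all (fun h => a h.1 (f h.1) != a h.2 (f h.2)) H.
  by apply/negP => all_f; apply: no_f; exists f.
by rewrite (big_rem h) //= eq_h subrr mul0r !mulr0.
Qed.

Local Open Scope nat_scope.

(** * Rainbow paths and list assignments *)

Section Rainbow.
Variable G : sgraph.
Implicit Types (x y v : G) (p : seq G) (c : {set G} -> nat).

Lemma adj_neq x y : adj x y -> x != y.
Proof. by apply: contraTneq => ->; rewrite adj_irr. Qed.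

Lemma mem_edges x y : adj x y -> [set x; y]%SET \in edges G.
Proof. by move=> xy; apply/imsetP; exists (x, y); rewrite ?inE. Qed.

Lemma path_edges_sub x p : path (@adj G) x p -> {subset path_edges x p <= edges G}.
Proof.
elim: p x => //= y p IH x /andP[xy py] e.
by rewrite inE => /predU1P[->|/(IH _ py)//]; apply: mem_edges.
Qed.

Lemma rainbow_size c k x y p : (forall e, e \in edges G -> c e < k) ->
  is_path x y p -> rainbow c x p -> size p <= k.
Proof.
move=> c_lt [xp _ _] c_uniq.
have <- : size (map c (path_edges x p)) = size p by rewrite size_map size_pairmap.
rewrite -[k](size_iota 0); apply: uniq_leq_size => // _ /mapP[e + ->].
by move=> /(path_edges_sub xp) eE; rewrite mem_iota c_lt.
Qed.

Lemma edge_list_assignment_inj r (L : {set G} -> set nat) e :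
  edge_list_assignment r L -> e \in edges G ->
  exists2 a : 'I_r -> nat, injective a & forall j, L e (a j).
Proof.
move=> L_r /L_r /pcard_leP/injfunPex[a aL a_inj].
exists (fun j => a (val j)) => [i j eq_a|j]; last exact: aL (ltn_ord j).
by apply/val_inj/a_inj; rewrite // mem_setE; apply: ltn_ord.
Qed.

End Rainbow.

Lemma is_least_xget (P : nat -> Prop) r : is_least P r -> xget 0 (is_least P) = r.
Proof.
move=> P_r; apply: xget_unique => // s P_s.
by apply/eqP; rewrite eqn_leq P_r.2 ?P_s.2 //; [case: P_r | case: P_s].
Qed.

(* [if] rather than [&&], so that call-by-value evaluation prunes the search. *)
Fixpoint extendable (T : eqType) (k : nat) (H : seq (T * T))
    (done : seq (T * nat)) (todo : seq T) : bool :=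
  if todo is i :: todo' then
    has (fun z =>
        if all (fun q => ((q.1, i) \in H) || ((i, q.1) \in H) ==> (q.2 != z)) done
        then extendable k H ((i, z) :: done) todo' else false)
      (iota 0 k)
  else true.

(** The search can always follow [g], so its failure refutes every proper colouring with [k]
    colours. *)
Lemma proper_extendable (T : eqType) k (H : seq (T * T)) (g : T -> nat) done todo :
  (forall i, g i < k) -> all (fun h => g h.1 != g h.2) H ->
  extendable k H [seq (i, g i) | i <- done] todo.
Proof.
move=> g_lt /allP g_H; elim: todo done => //= i todo IH done.
apply/hasP; exists (g i); rewrite ?mem_iota ?g_lt //=.
rewrite -[(i, g i) :: _]/[seq (i, g i) | i <- i :: done] IH ifT //.
apply/allP => _ /mapP[j _ ->] /=; apply/implyP => /orP[/g_H //|/g_H].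
by rewrite eq_sym.
Qed.

(** * The Petersen graph *)

Definition petersen_vertices : seq petersen :=
  [seq (b, inZp k) | k <- iota 0 5, b <- [:: false; true]].

Definition petersen_nbrs (v : petersen) : seq petersen :=
  [seq x <- petersen_vertices | adj v x].

Definition petersen_ids : seq 'I_15 := [seq inZp k | k <- iota 0 15].

(* [inZp] reduces modulo 5 on the second components. *)
Definition petersen_edge (k : 'I_15) : petersen * petersen :=
  if k < 5 then ((false, inZp k), (false, inZp k.+1))
  else if k < 10 then ((false, inZp k), (true, inZp k))
  else ((true, inZp k), (true, inZp k.+2)).

Definition petersen_set (k : 'I_15) : {set petersen} :=
  [set (petersen_edge k).1; (petersen_edge k).2]%SET.

(** Unlike [edge_index], this avoids finite sets and so evaluates by [vm_compute]. Nonadjacent pairs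
    get the default [ord0]. *)
Definition petersen_index (u v : petersen) : 'I_15 :=
  head ord0 [seq k <- petersen_ids |
    ((petersen_edge k).1 \in [:: u; v]) && ((petersen_edge k).2 \in [:: u; v])].

Definition edge_index (e : {set petersen}) : 'I_15 :=
  head ord0 [seq k <- petersen_ids |
    ((petersen_edge k).1 \in e) && ((petersen_edge k).2 \in e)].

Lemma mem_petersen_vertices v : v \in petersen_vertices.
Proof. by case: v => [[] [[|[|[|[|[|i]]]]] lti]]. Qed.

Lemma mem_petersen_ids k : k \in petersen_ids.
Proof. by rewrite -[k]valZpK; apply: map_f; rewrite mem_iota ltn_ord. Qed.

Lemma petersen_forall2 (P : rel petersen) :
  all (fun x => all (P x) petersen_vertices) petersen_vertices ->
  forall x y, P x y.
Proof.
by move=> /allP all_P x y; apply: (allP (all_P x _)); apply: mem_petersen_vertices.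
Qed.

Lemma edge_index_set2 u v : edge_index [set u; v]%SET = petersen_index u v.
Proof. by congr head; apply: eq_filter => k; rewrite !inE. Qed.

Lemma petersen_edge_adj k : adj (petersen_edge k).1 (petersen_edge k).2.
Proof.
apply: (allP (_ : all (fun k => adj (petersen_edge k).1 (petersen_edge k).2)
  petersen_ids)); last exact: mem_petersen_ids.
by vm_compute.
Qed.

Lemma petersen_set_edges k : petersen_set k \in edges petersen.
Proof. exact/mem_edges/petersen_edge_adj. Qed.

Lemma petersen_index_set (u v : petersen) : adj u v ->
  petersen_set (petersen_index u v) = [set u; v]%SET.
Proof.
have : adj u v ==> (petersen_edge (petersen_index u v) \in [:: (u, v); (v, u)]).
  by move: u v; apply: petersen_forall2; vm_compute.
move=> /implyP uvP /uvP; rewrite !inE /petersen_set => /orP[] /eqP -> //=.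
by rewrite finset.setUC.
Qed.

Lemma petersen_no_triangle (v x y : petersen) : adj v x -> adj v y -> ~~ adj x y.
Proof.
have /(_ v x) : forall v x,
    adj v x ==> all (fun y => adj v y ==> ~~ adj x y) petersen_vertices.
  by apply: petersen_forall2; vm_compute.
move=> /implyP vx /vx /allP /(_ y (mem_petersen_vertices y)).
by move=> /implyP.
Qed.

Lemma petersen_common_nbr (x y v z : petersen) : x != y ->
  adj v x -> adj v y -> adj z x -> adj z y -> z = v.
Proof.
have /(_ x y) : forall x y, (x != y) ==>
    (size [seq v <- petersen_vertices | adj v x && adj v y] <= 1).
  by apply: petersen_forall2; vm_compute.
move=> /implyP xy /xy; set s := filter _ _ => size_s vx vy zx zy.
have : v \in s by rewrite mem_filter vx vy mem_petersen_vertices.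
have : z \in s by rewrite mem_filter zx zy mem_petersen_vertices.
by case: s size_s => [|a [|b s]] //= _; rewrite !inE => /eqP -> /eqP ->.
Qed.

Definition petersen_dist (x y : petersen) : nat :=
  if x == y then 0 else if adj x y then 1 else 2.

Lemma petersen_dist_le x y p : is_path x y p -> petersen_dist x y <= size p.
Proof.
rewrite /petersen_dist => -[+ _ <-].
case: p => [|z [|z' p]] //=; rewrite ?eqxx ?andbT //.
  by move=> ->; case: ifP.
by case: ifP => //; case: ifP.
Qed.

(** The strict inequality keeps one order of each pair; listing both would change the
    coefficient. *)
Definition petersen_line : seq ('I_15 * 'I_15) :=
  flatten [seq [seq (petersen_index v xy.1, petersen_index v xy.2)
    | xy <- [seq (x, y) | x <- petersen_nbrs v, y <- petersen_nbrs v]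
    & petersen_index v xy.1 < petersen_index v xy.2] | v <- petersen_vertices].

Lemma petersen_line_proper (c : {set petersen} -> nat) :
  (forall v x y : petersen, x != y -> adj v x -> adj v y ->
    c [set v; x]%SET != c [set v; y]%SET) ->
  all (fun h => c (petersen_set h.1) != c (petersen_set h.2)) petersen_line.
Proof.
move=> c_proper; apply/allP => _ /flatten_mapP[v _ /mapP[[x y] + ->]] /=.
rewrite mem_filter /= => /andP[lt_xy /allpairsP[[x' y'] [/= + + [ex ey]]]].
rewrite -{}ex -{}ey !mem_filter => /andP[vx _] /andP[vy _].
have xy : x != y by apply: contraTneq lt_xy => ->; rewrite ltnn.
move: (c_proper v x y xy vx vy).
by rewrite -(petersen_index_set vx) -(petersen_index_set vy).
Qed.

(** The path can only be the one through [v]: an edge from [x] to [y] would close a triangle, and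
    [v] is their only common neighbour. *)
Lemma short_rainbow_proper (c : {set petersen} -> nat) (v x y : petersen) p :
  x != y -> adj v x -> adj v y -> is_path x y p -> size p <= 2 ->
  rainbow c x p -> c [set v; x]%SET != c [set v; y]%SET.
Proof.
move=> xy vx vy [xp _ yE]; case: p xp yE => [|z [|y' [|//]]] /=.
- by move=> _ yE; rewrite yE eqxx in xy.
- rewrite andbT => xz zE; rewrite zE in xz.
  by have /negP[] := petersen_no_triangle vx vy.
rewrite andbT => /andP[xz zy'] y'E _; rewrite y'E in zy' *.
have -> : v = z by apply: (petersen_common_nbr xy) => //; rewrite adj_sym.
by rewrite /rainbow /= inE andbT finset.setUC.
Qed.

Definition linked (H : seq ('I_15 * 'I_15)) : rel 'I_15 :=
  fun i j => ((i, j) \in H) || ((j, i) \in H).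

Lemma petersen_list_colouring r H d (L : {set petersen} -> set nat) :
  all (fun i => count_mem i d < r) petersen_ids -> size d = size H ->
  diff_coef H d != 0%R -> edge_list_assignment r L ->
  exists2 c, list_edge_colouring L c &
    forall x p, pairwise (linked H) (pairmap petersen_index x p) -> rainbow c x p.
Proof.
move=> d_lt size_d coef_d L_r.
have /choice[a a_spec] : forall i, exists a : 'I_r -> nat,
    injective a /\ forall j, L (petersen_set i) (a j).
  move=> i; have [a a_inj La] := edge_list_assignment_inj L_r (petersen_set_edges i).
  by exists a.
have [f /allP f_H] : exists f : 'I_15 -> 'I_r,
    all (fun h => (a h.1 (f h.1))%:R != (a h.2 (f h.2))%:R :> rat)%R H.
  apply: (@alon_tarsi rat _ _ (fun i j => (a i j)%:R)%R H d) => // [i j k /eqP|i].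
    by rewrite eqr_nat => /eqP /(a_spec i).1.
  exact: allP d_lt _ (mem_petersen_ids i).
pose g i := a i (f i).
exists (g \o edge_index) => [e /imsetP[[u v]]|x p].
  rewrite inE => uv -> /=; rewrite edge_index_set2 -(petersen_index_set uv).
  exact: (a_spec _).2.
rewrite /rainbow.
have <- : [seq g i | i <- pairmap petersen_index x p] =
    [seq (g \o edge_index) e | e <- path_edges x p].
  by elim: p x => //= y p IH x; rewrite IH edge_index_set2.
rewrite uniq_pairwise pairwise_map; apply: sub_pairwise => i j /=.
by case/orP => /f_H; rewrite eqr_nat //= eq_sym.
Qed.

(** * Path search and upper bounds *)

Fixpoint petersen_walks n x : seq (seq petersen) :=
  [::] :: if n is n'.+1 then
    flatten [seq [seq y :: p | p <- petersen_walks n' y] | y <- petersen_nbrs x]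
  else [::].

Definition linked_path H x y p :=
  [&& last x p == y, path (@adj petersen) x p, uniq (x :: p)
    & pairwise (linked H) (pairmap petersen_index x p)].

(* The adjacent pairs {2, 3}, {5, 10} and {7, 12} may be monochromatic: their end
   points are also joined by the paths 1-0-4, 0-1-7 and 1-6-14, which are rainbow
   once 1 and 4, 0 and 7, 1 and 14 differ. The coefficient of [\prod_i x_i ^ 2]
   is 6. *)
Definition rc_conflicts : seq ('I_15 * 'I_15) :=
  [:: (inZp 0, inZp 7); (inZp 1, inZp 4); (inZp 1, inZp 14)] ++
  [seq h <- petersen_line | h \notin
    [:: (inZp 2, inZp 3); (inZp 5, inZp 10); (inZp 7, inZp 12)]].

Lemma rc_conflicts_path x y :
  has (linked_path rc_conflicts x y) (petersen_walks 3 x).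
Proof. by move: x y; apply: petersen_forall2; vm_compute. Qed.

Lemma petersen_line_path x y :
  has (fun p => linked_path petersen_line x y p && (size p <= petersen_dist x y))
    (petersen_walks 2 x).
Proof. by move: x y; apply: petersen_forall2; vm_compute. Qed.

Lemma petersen_geodesic x y : exists2 p, is_geodesic x y p &
  pairwise (linked petersen_line) (pairmap petersen_index x p).
Proof.
have /hasP[p _ /andP[/and4P[/eqP yE xp p_uniq p_linked] p_dist]] :=
  petersen_line_path x y.
exists p => //; split; first by split.
by move=> q /petersen_dist_le; apply: leq_trans.
Qed.

Lemma petersen_rc_choosable3 : rc_choosable petersen 3.
Proof.
move=> L L_3.
(* Each of the 15 edges gets exponent 2, which matches the 30 pairs. *)
have [|||c cL c_rainbow] := petersen_list_colouring _ _ _ L_3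
  (H := rc_conflicts) (d := petersen_ids ++ petersen_ids);
  [by vm_compute | by vm_compute | by vm_compute | ].
exists c; split=> // x y.
have /hasP[p _ /and4P[/eqP yE xp p_uniq p_linked]] := rc_conflicts_path x y.
by exists p; split; [split | exact: c_rainbow].
Qed.

(* Exponents found by computer search; the coefficient is -1. *)
Definition src_exponents : seq 'I_15 :=
  flatten [seq nseq q.1 q.2 |
    q <- zip [:: 3; 3; 0; 1; 2; 1; 0; 3; 3; 3; 2; 2; 3; 3; 1] petersen_ids].

Lemma petersen_src_choosable4 : src_choosable petersen 4.
Proof.
move=> L L_4.
have [|||c cL c_rainbow] := petersen_list_colouring _ _ _ L_4
  (H := petersen_line) (d := src_exponents);
  [by vm_compute | by vm_compute | by vm_compute | ].
exists c; split=> // x y.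
by have [p p_geo /c_rainbow] := petersen_geodesic x y; exists p.
Qed.

(** * Lower bounds *)

Lemma petersen_rc_choosable_ge3 s : rc_choosable petersen s -> 3 <= s.
Proof.
move=> s_choosable; rewrite ltnNge; apply/negP => s_le.
(* Constant lists of two colours are admissible for every [s] up to 2. *)
have [|c [c_lt c_rc]] := s_choosable (fun _ => `I_2)%classic.
  by move=> e _; rewrite card_le_II.
have c_proper (v x y : petersen) : x != y -> adj v x -> adj v y ->
    c [set v; x]%SET != c [set v; y]%SET.
  move=> xy vx vy; have [p [p_path p_rainbow]] := c_rc x y.
  exact: (short_rainbow_proper xy vx vy p_path (rainbow_size c_lt p_path p_rainbow)).
(* The three edges at [v] would need distinct colours among two. *)
pose v : petersen := (false, inZp 0).
pose x : petersen := (false, inZp 1).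
pose y : petersen := (false, inZp 4).
pose z : petersen := (true, inZp 0).
have := c_proper v x y isT isT isT; have := c_proper v x z isT isT isT.
have := c_proper v y z isT isT isT.
have := c_lt _ (@mem_edges petersen v x isT).
have := c_lt _ (@mem_edges petersen v y isT).
have := c_lt _ (@mem_edges petersen v z isT).
by rewrite /=; case: (c _) => [|[|?]]; case: (c _) => [|[|?]]; case: (c _) => [|[|?]].
Qed.

(** The classical fact that the chromatic index exceeds 3, by exhaustive search. *)
Lemma petersen_line_not_extendable :
  ~~ extendable 3 petersen_line [::] petersen_ids.
Proof. by vm_compute. Qed.

Lemma petersen_src_choosable_ge4 s : src_choosable petersen s -> 4 <= s.
Proof.
move=> s_choosable; rewrite ltnNge; apply/negP => s_le.
have [|c [c_lt c_src]] := s_choosable (fun _ => `I_3)%classic.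
  by move=> e _; rewrite card_le_II.
have c_proper (v x y : petersen) : x != y -> adj v x -> adj v y ->
    c [set v; x]%SET != c [set v; y]%SET.
  move=> xy vx vy; have [p [[p_path p_min] p_rainbow]] := c_src x y.
  apply: (short_rainbow_proper xy vx vy p_path _ p_rainbow).
  (* The path through [v] bounds the geodesic's length by 2. *)
  apply: (p_min [:: v; y]); have xv : adj x v by rewrite adj_sym.
  split=> //; first by apply/and3P; split.
  by rewrite /= !inE negb_or xy (adj_neq xv) (adj_neq vy).
have := proper_extendable [::] petersen_ids (fun i => c_lt _ (petersen_set_edges i))
  (petersen_line_proper c_proper).
by rewrite (negPf petersen_line_not_extendable).
Qed.

Theorem theorem3p16 : rcl petersen = 3 /\ srcl petersen = 4.
Proof.
split; apply: is_least_xget; split.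
- exact: petersen_rc_choosable3.
- exact: petersen_rc_choosable_ge3.
- exact: petersen_src_choosable4.
- exact: petersen_src_choosable_ge4.
Qed.
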